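(* Let $D:\mathbb{R}^n\to(0,\infty)$ be a differentiable decision function, with the continuous action space under the Euclidean ($L_2$) norm described in the context. The greedy policy (equivalently, the gradient-following policy) is optimal for $D$ only if the gradient field of $D$ consists of straight lines wherever $\nabla D\neq 0$; that is, if the policy is optimal for $D$, then every integral curve of $\nabla D$ contained in $\{x\in\mathbb{R}^n:\nabla D(x)\neq0\}$ has image contained in a straight line.
   Context: The state of an individual is $(x,r)$, where $x\in\mathbb{R}^n$ is the feature vector and $r\ge 0$ is the remaining available displacement (resources). Every coordinate of $x$ can be manipulated independently: the individual can move $x$ in any direction, and the cost of a movement is its Euclidean length, so from $(x_0,r)$ the set of reachable final feature vectors is the closed ball $\{x:\|x-x_0\|_2\le r\}$ (the individual may stop early). The individual wants to maximize the value of $D$ at the final feature vector. For this continuous action space, the greedy policy, which maximizes the immediate improvement in $D$, is the gradient-following policy: at each point take an infinitesimal step in the direction of $\nabla D$, and remain in place where $\nabla D=0$. A gradient-following trajectory from $x_0$ with budget $r$ is a continuous curve $\gamma:[0,\ell]\to\mathbb{R}^n$ with $0\le\ell\le r$ and $\gamma(0)=x_0$, such that for all $t\in[0,\ell)$ one has $\nabla D(\gamma(t))\ne0$ and $\gamma'(t)=\nabla D(\gamma(t))/\|\nabla D(\gamma(t))\|_2$ (one-sided at $t=0$), and such that either $\ell=r$ or $\nabla D(\gamma(\ell))=0$. Its final point is $\gamma(\ell)$. The policy is optimal for $D$ if, for every $x_0\in\mathbb{R}^n$ and every $r\ge0$, following it from $x_0$ with budget $r$ ends at a best reachable point: a gradient-following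 trajectory from $x_0$ with budget $r$ exists, and each such trajectory $\gamma$ satisfies $D(\gamma(\ell))=\max_{\|x-x_0\|_2\le r}D(x)$. An integral curve of $\nabla D$ is a differentiable curve $\eta$ on an interval with $\eta'(t)=\nabla D(\eta(t))$. *)

(* Defs.v *)
From HB Require Import structures.
From mathcomp Require Import all_boot all_order all_algebra.
From mathcomp Require Import all_classical all_reals all_analysis.

Set Implicit Arguments.
Unset Strict Implicit.
Unset Printing Implicit Defensive.

Import Order.TTheory GRing.Theory Num.Theory.
Import numFieldNormedType.Exports.

Local Open Scope classical_set_scope.
Local Open Scope ring_scope.

Section GradientFollowing.
Context {R : realType} {n : nat}.
Implicit Types (D : 'rV[R]_n -> R) (x a v : 'rV[R]_n).

(* The library norm `|x| on 'rV[R]_n is the sup norm.  It induces the same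
   topology, derivatives and differentiability as the Euclidean norm, so it is
   only replaced where an actual length is measured. *)
Definition norm2 x : R := Num.sqrt (\sum_(i < n) x ord0 i ^+ 2).

Definition cball2 x0 (r : R) : set 'rV[R]_n := [set x | norm2 (x - x0) <= r].

Definition grad D x : 'rV[R]_n := \row_(i < n) 'D_(delta_mx ord0 i) D x.

(* At a point t of an interval A with nonempty interior this is the ordinary
   derivative if t is interior to A and the one-sided derivative if t is an
   endpoint.  If A is reduced to t, the filter is trivial and the predicate
   holds for every v. *)
Definition has_deriv_within (A : set R) (c : R -> 'rV[R]_n) (t : R) v : Prop :=
  (s - t)^-1 *: (c s - c t) @[s --> within A t^'] --> v.

Definition gradient_following D x0 (r l : R) (g : R -> 'rV[R]_n) : Prop :=
  [/\ 0 <= l <= r,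
      {within `[0, l], continuous g},
      g 0 = x0,
      forall t : R, 0 <= t < l ->
        grad D (g t) != 0 /\
        has_deriv_within `[0, l] g t
          ((norm2 (grad D (g t)))^-1 *: grad D (g t)) &
      l = r \/ grad D (g l) = 0].

Definition is_max_on (A : set 'rV[R]_n) D (m : R) : Prop :=
  (D @` A) m /\ ubound (D @` A) m.

Definition gradient_policy_optimal D : Prop :=
  forall x0 (r : R), 0 <= r ->
    (exists (l : R) (g : R -> 'rV[R]_n), gradient_following D x0 r l g) /\
    (forall (l : R) (g : R -> 'rV[R]_n), gradient_following D x0 r l g ->
       is_max_on (cball2 x0 r) D (D (g l))).

Definition integral_curve D (I : interval R) (c : R -> 'rV[R]_n) : Prop :=
  forall t : R, t \in I -> has_deriv_within [set` I] c t (grad D (c t)).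

Definition line a v : set 'rV[R]_n := range (fun s : R => a + s *: v).

Definition in_straight_line (A : set 'rV[R]_n) : Prop :=
  exists a v, v != 0 /\ A `<=` line a v.

End GradientFollowing.

(* Main.v *)
(* Let eta be an integral curve and let x = eta(t) lie before b on it.  With
   budget r = dist(x, {D >= D(eta(b))}), optimality forces a greedy trajectory
   from x to end in that superlevel set.  It moves at unit speed, hence spends
   the whole budget on a straight segment whose direction is that of grad D at
   x: a nearest point of the superlevel set lies on the gradient ray of x.
   Therefore the distance from eta(t) to the superlevel set decreases at rate at
   least |eta'(t)|, so the length of eta between a and b is at most the distance
   of eta(a) to the superlevel set, which is at most |eta(a) - eta(b)|.  A curve
   no longer than its chord is straight. *)
Require Import Defs.
From HB Require Import structures.
From mathcomp Require Import all_boot all_order all_algebra.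
From mathcomp Require Import all_classical all_reals all_analysis.
From mathcomp Require Import lra.

Set Implicit Arguments.
Unset Strict Implicit.
Unset Printing Implicit Defensive.

Import Order.TTheory GRing.Theory Num.Theory.
Import numFieldNormedType.Exports.

Local Open Scope classical_set_scope.
Local Open Scope ring_scope.

(** * Euclidean inner product, norm and nearest points *)

Section EuclideanSpace.
Context {R : realType} {n : nat}.
Implicit Types (x y z u v w : 'rV[R]_n) (a b c t : R).

Definition dot x y : R := \sum_(i < n) x ord0 i * y ord0 i.

Lemma dotC x y : dot x y = dot y x.
Proof. by apply: eq_bigr => i _; rewrite mulrC. Qed.

Lemma dotDl x y z : dot (x + y) z = dot x z + dot y z.
Proof. by rewrite /dot -big_split; apply: eq_bigr => i _; rewrite mxE mulrDl. Qed.

Lemma dotZl a x y : dot (a *: x) y = a * dot x y.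
Proof. by rewrite /dot mulr_sumr; apply: eq_bigr => i _; rewrite mxE mulrA. Qed.

Lemma dotNl x y : dot (- x) y = - dot x y.
Proof. by rewrite -scaleN1r dotZl mulN1r. Qed.

Lemma dotBl x y z : dot (x - y) z = dot x z - dot y z.
Proof. by rewrite dotDl dotNl. Qed.

Lemma dotDr x y z : dot x (y + z) = dot x y + dot x z.
Proof. by rewrite dotC dotDl !(dotC x). Qed.

Lemma dotZr a x y : dot x (a *: y) = a * dot x y.
Proof. by rewrite dotC dotZl (dotC y). Qed.

Lemma dotBr x y z : dot x (y - z) = dot x y - dot x z.
Proof. by rewrite dotC dotBl !(dotC x). Qed.

Lemma dotxx_ge0 x : 0 <= dot x x.
Proof. by apply: sumr_ge0 => i _; rewrite -expr2 sqr_ge0. Qed.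

Lemma dotxx_eq0 x : dot x x = 0 -> x = 0.
Proof.
move=> /eqP; rewrite psumr_eq0 => [/allP x0|i _]; last by rewrite -expr2 sqr_ge0.
apply/rowP => i; rewrite mxE.
by have := x0 i (mem_index_enum i); rewrite -expr2 sqrf_eq0 => /eqP.
Qed.

Lemma norm2E x : norm2 x = Num.sqrt (dot x x).
Proof. by congr Num.sqrt; apply: eq_bigr => i _; rewrite expr2. Qed.

Lemma sqr_norm2 x : norm2 x ^+ 2 = dot x x.
Proof. by rewrite norm2E sqr_sqrtr ?dotxx_ge0. Qed.

Lemma norm2_ge0 x : 0 <= norm2 x.
Proof. exact: sqrtr_ge0. Qed.

Lemma norm2_eq0 x : (norm2 x == 0) = (x == 0).
Proof.
apply/eqP/eqP => [x0|->]; last by rewrite norm2E -(scale0r 0) dotZl mul0r sqrtr0.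
by apply: dotxx_eq0; rewrite -sqr_norm2 x0 expr0n.
Qed.

Lemma norm2_gt0 x : (0 < norm2 x) = (x != 0).
Proof. by rewrite lt0r norm2_ge0 norm2_eq0 andbT. Qed.

Lemma norm2Z a x : norm2 (a *: x) = `|a| * norm2 x.
Proof.
by rewrite !norm2E dotZl dotZr mulrA -expr2 sqrtrM ?sqr_ge0// sqrtr_sqr.
Qed.

Lemma norm2N x : norm2 (- x) = norm2 x.
Proof. by rewrite -scaleN1r norm2Z normrN1 mul1r. Qed.

Lemma norm2BC x y : norm2 (x - y) = norm2 (y - x).
Proof. by rewrite -norm2N opprB. Qed.

Lemma dot_le_norm2 x y : dot x y <= norm2 x * norm2 y.
Proof.
have [->|x0] := eqVneq x 0.
  by rewrite -(scale0r 0) dotZl mul0r mulr_ge0 ?norm2_ge0.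
have [->|y0] := eqVneq y 0.
  by rewrite -(scale0r 0) dotZr mul0r mulr_ge0 ?norm2_ge0.
have : 0 < norm2 x * norm2 y by rewrite mulr_gt0 ?norm2_gt0.
(* This square expands to [2 * N * (N - dot x y)] with [N = norm2 x * norm2 y], and the factor [N]
   is positive. *)
have := dotxx_ge0 (norm2 y *: x - norm2 x *: y).
rewrite !(dotBl, dotBr, dotZl, dotZr) (dotC y x) -!sqr_norm2 => h xy0.
rewrite -(ler_pM2l xy0); nra.
Qed.

Lemma norm2D x y : norm2 (x + y) <= norm2 x + norm2 y.
Proof.
rewrite -(ler_pXn2r (ltn0Sn 1)) ?nnegrE ?addr_ge0 ?norm2_ge0//.
rewrite sqr_norm2 dotDl !dotDr (dotC y x) -!sqr_norm2.
have := dot_le_norm2 x y; nra.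
Qed.

Lemma norm2_triangle y x z : norm2 (x - z) <= norm2 (x - y) + norm2 (y - z).
Proof. by rewrite -[x - z](subrKA y) norm2D. Qed.

(** Strict convexity of the Euclidean norm: equality in the triangle inequality forces equality in
    Cauchy-Schwarz, so [x - y] and [y - z] are positive multiples of each other. *)
Lemma norm2_triangle_eq y x z :
  x != y -> y != z -> norm2 (x - y) + norm2 (y - z) <= norm2 (x - z) ->
  exists2 t, 0 < t < 1 & y = x + t *: (z - x).
Proof.
rewrite -subr_eq0 -norm2_gt0 -(subr_eq0 y) -norm2_gt0 => xy yz xyz.
set p := x - y in xy xyz *; set q := y - z in yz xyz *.
have pq : x - z = p + q by rewrite /p /q subrKA.
have yE : y = x - p by rewrite /p subKr.
clearbody p q.
have pqE : norm2 q *: p = norm2 p *: q.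
  apply/eqP; rewrite -subr_eq0; apply/eqP/dotxx_eq0/eqP.
  rewrite eq_le dotxx_ge0 andbT.
  have : (norm2 p + norm2 q) ^+ 2 <= dot (p + q) (p + q).
    by rewrite -sqr_norm2 -pq ler_pXn2r ?nnegrE ?addr_ge0 ?norm2_ge0.
  rewrite !(dotBl, dotBr, dotZl, dotZr, dotDl, dotDr) (dotC q p) -!sqr_norm2.
  move=> h; have : norm2 p * norm2 q <= dot p q by nra.
  by rewrite -(ler_pM2l (mulr_gt0 xy yz)); nra.
exists (norm2 p / (norm2 p + norm2 q)).
  by rewrite divr_gt0 ?addr_gt0//= ltr_pdivrMr ?addr_gt0// mul1r ltrDl.
rewrite yE -(opprB x z) pq scalerN; congr (_ - _).
have s0 : norm2 p + norm2 q != 0 by rewrite gt_eqF ?addr_gt0.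
apply: (scalerI s0); rewrite scalerA mulrCA divff// mulr1.
by rewrite scalerDr -pqE -scalerDl addrC.
Qed.

(** Bridge to the sup norm, in which boundedness and the remainder of the differential are
    measured. *)
Lemma normr_le_norm2 x : `|x| <= norm2 x.
Proof.
rewrite /Num.norm/= mx_normrE; apply: bigmax_le => [|[i j] _]; first exact: norm2_ge0.
rewrite /= (ord1 i) norm2E -sqrtr_sqr ler_wsqrtr// /dot (bigD1 j)//= -expr2.
by rewrite lerDl sumr_ge0// => k _; rewrite -expr2 sqr_ge0.
Qed.

Lemma norm2_continuous : continuous (norm2 : 'rV[R]_n -> R).
Proof.
move=> x; apply: (@continuous_comp _ _ _ (fun y => \sum_i y ord0 i ^+ 2)).
  apply: continuous_big => [|i _ z]; first exact: add_continuous.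
  apply: (@continuous_comp _ _ _ _ (fun a => a ^+ 2)).
    exact: coord_continuous.
  exact: exprn_continuous.
exact: sqrt_continuous.
Qed.

Lemma norm2B_continuous x : continuous (fun y => norm2 (x - y)).
Proof.
move=> y; apply: (@continuous_comp _ _ _ (fun y => x - y)).
  exact: (cvgB (cvg_cst _) cvg_id).
exact: norm2_continuous.
Qed.

(** Exchanging [x] and [y] gives the other half of the Lipschitz bound. The distance to a superlevel
    set is such an [f]. *)
Lemma norm2_lipschitz_continuous (f : 'rV[R]_n -> R) :
  (forall x y, f x - f y <= norm2 (x - y)) -> continuous f.
Proof.
move=> fB x; rewrite /continuous_at.
apply/(@cvgrPdist_le _ _ _ _ (nbhs_filter x)) => e e0.
have xe : nbhs (norm2 (x - x)) [set r | r < e].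
  apply: lt_nbhsl; by rewrite (eqP (_ : norm2 (x - x) == 0)) ?norm2_eq0 ?subrr.
apply: (@filterS _ _ (nbhs_filter x) _ _ _ (norm2B_continuous xe)) => y /ltW xy.
rewrite ler_norml (le_trans (fB _ _) xy) andbT lerNl opprB.
by rewrite (le_trans (fB _ _))// norm2BC.
Qed.

Lemma dot_continuous w : continuous (dot^~ w).
Proof.
apply: continuous_big => [|i _ x]; first exact: add_continuous.
apply: (@continuous_comp _ _ _ (fun y : 'rV[R]_n => y ord0 i) (fun a => a * w ord0 i)).
  exact: coord_continuous.
exact: mulrr_continuous.
Qed.

Lemma cball2_closed x a : closed (cball2 x a).
Proof.
rewrite (_ : cball2 x a = (fun y => norm2 (y - x)) @^-1` [set b | b <= a])//.
apply: preimage_closed; last exact: closed_le.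
move=> y _; apply: (@continuous_comp _ _ _ (fun y => y - x)).
  exact: (cvgB cvg_id (cvg_cst _)).
exact: norm2_continuous.
Qed.

Lemma cball2_compact x a : compact (cball2 x a).
Proof.
apply: bounded_closed_compact; last exact: cball2_closed.
exists (a + `|x|); split => [|M aM y]; first exact: num_real.
rewrite /cball2 /= => yxa; apply: le_trans (ltW aM).
rewrite -[in leLHS](subrK x y); apply: (le_trans (ler_normD _ _)).
by rewrite lerD2r (le_trans _ yxa)// normr_le_norm2.
Qed.

(** Only the part of [A] in the closed ball around [x] through some [q] of [A] matters; it is
    compact, so the distance attains its minimum there. *)
Lemma closed_nearest_point (A : set 'rV[R]_n) x :
  A !=set0 -> closed A ->
  exists2 p, A p & forall y, A y -> norm2 (x - p) <= norm2 (x - y).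
Proof.
move=> [q Aq] cA; pose B := A `&` cball2 x (norm2 (x - q)).
have Bq : B q by split => //; rewrite /cball2 /= norm2BC.
have cB : compact B.
  rewrite /B setIC; apply: compact_closedI => //; exact: cball2_compact.
have [p pB pmin] : exists2 p, p \in B &
    forall y, y \in B -> norm2 (x - p) <= norm2 (x - y).
  apply: EVT_min_rV => //; first by exists q.
  by apply: continuous_subspaceT; exact: norm2B_continuous.
move/set_mem: pB => [Ap _]; exists p => // y Ay.
have [yq|/ltW qy] := leP (norm2 (x - y)) (norm2 (x - q)).
  by apply: pmin; apply/mem_set; split=> //; rewrite /cball2 /= (norm2BC y).
by apply: le_trans qy; apply: pmin; exact/mem_set.
Qed.

End EuclideanSpace.

(** * Growth estimates from one-sided derivatives *)

Section RightDerivative.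
Context {R : realType} {n : nat}.
Implicit Types (a b t : R) (v w : 'rV[R]_n) (c : R -> 'rV[R]_n).

(** Supremum argument: the last point where [f] stays below the line of slope [e] from [(a, f a)]
    cannot precede [b], since the right-hand estimate carries the bound further. It plays the role
    of the mean value theorem for functions controlled only to the right. *)
Lemma nonincreasing_right_dini (f : R -> R) a b :
  a <= b -> {within `[a, b], continuous f} ->
  (forall t e, a <= t < b -> 0 < e ->
    \forall s \near t^'+, f s <= f t + e * (s - t)) ->
  f b <= f a.
Proof.
move=> ab cf df; apply/ler_addgt0Pr => e0 e0_gt0.
have [e e_gt0 ee0] : exists2 e, 0 < e & e * (b - a) <= e0.
  (* The [1 +] keeps the denominator positive when [a = b]. *)
  exists (e0 / (1 + (b - a))); first by rewrite divr_gt0//; lra.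
  by rewrite mulrAC ler_pdivrMr ?ler_pM2l//; lra.
suff : f b - e * (b - a) <= f a by lra.
pose g t := f t - e * (t - a).
pose S := `[a, b] `&` g @^-1` [set y | y <= f a].
have cg : {within `[a, b], continuous g}.
  apply/subspace_continuousP => t tab; apply: cvgB.
    by move/subspace_continuousP : cf; exact.
  by apply: cvg_within_filter; apply: cvgMl_tmp; exact: (cvgB cvg_id (cvg_cst _)).
have cS : closed S.
  rewrite /S closed_setSI; last exact: interval_closed.
  by move/continuous_closedP : cg; apply; exact: closed_le.
have Sa : S a by split; rewrite /= ?in_itv/= ?lexx// /g subrr mulr0 subr0.
have ubS : has_ubound S by exists b => t [/=]; rewrite in_itv/= => /andP[].
have [/=] : S (sup S) by apply: cS; apply: closure_sup => //; exists a.
rewrite in_itv/= => /andP[aT]; rewrite le_eqVlt => /predU1P[->//|Tb gT].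
have /filter_ex[s [[sb Ts] fs]] : \forall s \near (sup S)^'+,
    (s < b /\ sup S < s) /\ f s <= f (sup S) + e * (s - sup S).
  apply: filterI; last by apply: df => //; rewrite aT Tb.
  by apply: filterI; [exact: nbhs_right_lt|exact: nbhs_right_gt].
suff Ss : S s by have := ub_le_sup ubS Ss; rewrite leNgt Ts.
split; rewrite /= ?in_itv/=; first by rewrite (le_trans aT (ltW Ts)) ltW.
by move: gT fs; rewrite /g; lra.
Qed.

(** Division-free and in the Euclidean norm: the form from which Cauchy-Schwarz and the triangle
    inequality yield the hypothesis of [nonincreasing_right_dini]. *)
Definition right_deriv c t v := forall e, 0 < e ->
  \forall s \near t^'+, norm2 (c s - c t - (s - t) *: v) <= e * (s - t).

Lemma has_deriv_within_right (A : set R) c t b v :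
  t < b -> `[t, b] `<=` A -> has_deriv_within A c t v -> right_deriv c t v.
Proof.
move=> tb tbA cv e e_gt0.
have /cvgr_lt/(_ _ e_gt0) dq :
    norm2 ((s - t)^-1 *: (c s - c t) - v) @[s --> within A t^'] --> (0 : R).
  rewrite [X in _ --> X](_ : _ = norm2 (v - v)); last first.
    by apply/esym/eqP; rewrite norm2_eq0 subrr.
  apply: (continuous_cvg _ (@norm2_continuous _ _ _)).
  by apply: cvgB => //; exact: cvg_cst.
near=> s.
have ts : t < s by near: s; exact: nbhs_right_gt.
have sb : s < b by near: s; exact: nbhs_right_lt.
have st0 : 0 < s - t by rewrite subr_gt0.
have : s != t -> A s -> norm2 ((s - t)^-1 *: (c s - c t) - v) < e.
  by near: s; apply: cvg_within; exact: dq.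
move=> /(_ (negbT (gt_eqF ts))) dqs.
have -> : c s - c t - (s - t) *: v = (s - t) *: ((s - t)^-1 *: (c s - c t) - v).
  by rewrite scalerBr scalerA divff ?gt_eqF// scale1r.
rewrite norm2Z gtr0_norm// mulrC ler_pM2r// ltW// dqs//.
by apply: tbA; rewrite /= in_itv/= !ltW.
Unshelve. all: by end_near. Qed.

Lemma has_deriv_within_continuous (A : set R) c (d : R -> 'rV[R]_n) :
  (forall t, A t -> has_deriv_within A c t (d t)) -> {within A, continuous c}.
Proof.
move=> dc; apply/subspace_continuousP => t At.
have cq : c s @[s --> within A t^'] --> c t.
  have : c t + (s - t) *: ((s - t)^-1 *: (c s - c t)) @[s --> within A t^'] -->
      c t + (t - t) *: d t.
    apply: cvgD; first exact: cvg_cst.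
    apply: cvgZ; last exact: dc.
    do 2 apply: cvg_within_filter; exact: (cvgB cvg_id (cvg_cst _)).
  rewrite subrr scale0r addr0; apply: cvg_trans; apply: near_eq_cvg.
  apply: cvg_within; near=> s.
  have st : s != t by near: s; exact: nbhs_dnbhs_neq.
  by rewrite scalerA divff ?subr_eq0// scale1r addrC subrK.
move=> U Ut; have : nbhs t [set s | s != t -> A s -> U (c s)] by exact: (cq U Ut).
apply: filterS => s sU As; have [->|/sU] := eqVneq s t; last exact.
exact: (nbhs_singleton Ut).
Unshelve. all: by end_near. Qed.

(** By Cauchy-Schwarz [dot v w <= 1], so [dot (c t) w - t] has nonpositive right derivative. *)
Lemma dot_increment_le c a b w :
  a <= b -> {within `[a, b], continuous c} -> norm2 w <= 1 ->
  (forall t, a <= t < b -> exists2 v, norm2 v <= 1 & right_deriv c t v) ->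
  dot (c b - c a) w <= b - a.
Proof.
move=> ab cc w1 dc.
suff : dot (c b) w - b <= dot (c a) w - a by rewrite dotBl; lra.
apply: (@nonincreasing_right_dini (fun t => dot (c t) w - t)) => //.
  apply/subspace_continuousP => t tab; apply: cvgB.
    apply: (continuous_cvg _ (@dot_continuous _ _ w _)).
    by move/subspace_continuousP : cc; exact.
  by apply: cvg_within_filter; exact: cvg_id.
move=> t e /dc[v v1 cv] e_gt0; near=> s.
have ts : t < s by near: s; exact: nbhs_right_gt.
have cs : norm2 (c s - c t - (s - t) *: v) <= e * (s - t) by near: s; exact: cv.
have := dot_le_norm2 (c s - c t - (s - t) *: v) w.
have := dot_le_norm2 v w; rewrite !dotBl dotZl.
have := norm2_ge0 w; have := norm2_ge0 v.
have := norm2_ge0 (c s - c t - (s - t) *: v).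
set N := norm2 (_ - _) in cs *; move=> N0 v0 w0 vw Nw.
have : N * norm2 w <= N by rewrite ler_piMr.
have : (s - t) * dot v w <= s - t by rewrite ler_piMr//; nra.
lra.
Unshelve. all: by end_near. Qed.

(** Testing against [u] turns a bound on a norm into one on a linear function, which can be
    differentiated along a curve. For [w = 0] the normalised vector is zero, hence only
    [norm2 u <= 1]. *)
Lemma unit_dual w : exists2 u, norm2 u <= 1 & dot w u = norm2 w :> R.
Proof.
exists ((norm2 w)^-1 *: w).
  rewrite norm2Z ger0_norm ?invr_ge0 ?norm2_ge0//.
  by have [->|w0] := eqVneq (norm2 w) 0; rewrite ?mulr0// mulVf.
rewrite dotZr -sqr_norm2; have [->|w0] := eqVneq (norm2 w) 0.
  by rewrite expr0n mulr0.
by rewrite expr2 mulKf.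
Qed.

Lemma norm2_increment_le c a b :
  a <= b -> {within `[a, b], continuous c} ->
  (forall t, a <= t < b -> exists2 v, norm2 v <= 1 & right_deriv c t v) ->
  norm2 (c b - c a) <= b - a.
Proof.
move=> ab cc dc; have [w w1 <-] := unit_dual (c b - c a).
exact: dot_increment_le.
Qed.

End RightDerivative.

(** * Gradient-following trajectories and integral curves *)

Section GradientPolicy.
Context {R : realType} {n : nat}.
Implicit Types (D : 'rV[R]_n -> R) (x p : 'rV[R]_n).

Lemma diff_dot_grad D x v : differentiable D x -> 'd D x v = dot (grad D x) v.
Proof.
move=> dD; rewrite {1}[v]row_sum_delta linear_sum; apply: eq_bigr => i _.
by rewrite linearZ mxE deriveE// mulrC.
Qed.

Lemma right_deriv_grad_lt D (c : R -> 'rV[R]_n) (t : R) :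
  differentiable D (c t) -> grad D (c t) != 0 ->
  right_deriv c t (grad D (c t)) ->
  \forall s \near t^'+, D (c t) < D (c s).
Proof.
move=> dD; rewrite -norm2_gt0; set v := grad D (c t) => v0 cv.
(* With [N = norm2 v], the gain in [D] is at least [(N^2 - 2eN - e^2)(s - t)]; this [e] leaves
   [7/16] of the main term. *)
pose e := norm2 v / 4; have e0 : 0 < e by rewrite divr_gt0.
have /eqaddoP/(_ e e0)/nbhs_normP[d /= d0 Dd] := diff_locally dD.
near=> s.
have ts : t < s by near: s; exact: nbhs_right_gt.
(* Keeps the increment of [c] within the radius [d] where the remainder of [D] is controlled. *)
have sd : s < t + d / (norm2 v + e).
  by near: s; apply: nbhs_right_lt; rewrite ltrDl divr_gt0// addr_gt0.
have cs : norm2 (c s - c t - (s - t) *: v) <= e * (s - t) by near: s; exact: cv.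
have kle : norm2 (c s - c t) <= (norm2 v + e) * (s - t).
  have := norm2D (c s - c t - (s - t) *: v) ((s - t) *: v).
  by rewrite subrK norm2Z gtr0_norm ?subr_gt0//; lra.
have kd : norm2 (c s - c t) < d.
  rewrite (le_lt_trans kle)// mulrC -ltr_pdivlMr ?addr_gt0//.
  by rewrite ltrBlDl.
have := Dd (c s - c t).
rewrite /ball_ /= sub0r normrN (le_lt_trans (normr_le_norm2 _) kd) => /(_ isT).
rewrite /= !fctE /= subrK diff_dot_grad// -/v ler_norml => /andP[Dge _].
have := dot_le_norm2 (- v) (c s - c t - (s - t) *: v).
rewrite dotNl norm2N dotBr dotZr -sqr_norm2 => vk.
have := normr_le_norm2 (c s - c t) => knorm.
have : norm2 v * norm2 (c s - c t - (s - t) *: v) <= norm2 v * (e * (s - t)).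
  by rewrite ler_pM2l.
have : e * `|c s - c t| <= e * ((norm2 v + e) * (s - t)).
  by rewrite ler_pM2l// (le_trans knorm).
have : 0 < (norm2 v ^+ 2) * (s - t) by rewrite mulr_gt0 ?exprn_gt0 ?subr_gt0.
move: Dge vk; rewrite /e; nra.
Unshelve. all: by end_near. Qed.

Lemma gradient_following_right D x r l (g : R -> 'rV[R]_n) t :
  gradient_following D x r l g -> 0 <= t < l ->
  let u := (norm2 (grad D (g t)))^-1 *: grad D (g t) in
  norm2 u = 1 /\ right_deriv g t u.
Proof.
move=> [_ _ _ dg _] /[dup] tl /dg[g0 gt] u; split.
  by rewrite norm2Z ger0_norm ?invr_ge0 ?norm2_ge0// mulVf ?norm2_eq0.
have /andP[t0 tl'] := tl.
apply: has_deriv_within_right tl' _ gt => s /=.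
by rewrite !in_itv/= => /andP[ts ->]; rewrite (le_trans t0).
Qed.

(* A trajectory whose budget is the distance to the superlevel set of [D p] can
   only enter that set by moving along a straight segment at unit speed. *)
Lemma gradient_ray_reaches_level D x p :
  gradient_policy_optimal D -> D x < D p ->
  (forall y, D p <= D y -> norm2 (x - p) <= norm2 (x - y)) ->
  D p <= D (x + norm2 (x - p) *: ((norm2 (grad D x))^-1 *: grad D x)).
Proof.
move=> Dopt Dxp pmin; set r := norm2 (x - p) in pmin *.
have xp : x != p by apply: contraTneq Dxp => ->; rewrite ltxx.
have r0 : 0 < r by rewrite norm2_gt0 subr_eq0.
have [[l [g gf]] /(_ _ _ gf)[_ gmax]] := Dopt x r (ltW r0).
have Dpg : D p <= D (g l) by apply: gmax; exists p => //; rewrite /cball2 /= norm2BC.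
have [/andP[l0 lr] cg g0 _ _] := gf.
have gu t : 0 <= t < l -> exists2 v, norm2 v <= 1 & right_deriv g t v.
  by move=> /(gradient_following_right gf)[/= u1 gu]; eexists; [|exact: gu]; rewrite u1.
(* The endpoint is at distance at least [r] from [x] by minimality of [p], and at most [l <= r] by
   unit speed. *)
have lE : l = r /\ norm2 (g l - x) = r.
  have := norm2_increment_le l0 cg gu; rewrite g0 subr0.
  by have := pmin _ Dpg; rewrite norm2BC => *; split; lra.
case: lE => lE glr; rewrite lE in gf cg gu Dpg glr *; move: lE => _.
pose w := r^-1 *: (g r - x).
have w1 : norm2 w = 1 by rewrite norm2Z glr gtr0_norm ?invr_gt0// mulVf ?gt_eqF.
have grE : g r = x + r *: w by rewrite scalerA divff ?gt_eqF// scale1r addrC subrK.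
have r00 : 0 <= (0 : R) < r by rewrite lexx r0.
have [/= u1 gu0] := gradient_following_right gf r00.
rewrite g0 in u1 gu0; set u := _ *: grad D x in u1 gu0 *.
suff -> : u = w by rewrite -grE.
(* From [s] to [r] the component along [w] gains at most [r - s]; as it totals [r], it is already at
   least [s] at time [s]. *)
have dotw s : 0 <= s <= r -> s <= dot (g s - x) w.
  move=> /andP[s0 sr].
  have : dot (g r - g s) w <= r - s.
    apply: dot_increment_le; rewrite ?w1//.
      apply: continuous_subspaceW cg => t /=; rewrite !in_itv/= => /andP[st ->].
      by rewrite (le_trans s0).
    by move=> t /andP[st tr]; apply: gu; rewrite (le_trans s0).
  by rewrite grE !dotBl !dotDl dotZl -sqr_norm2 w1; lra.
(* As [s] tends to zero, the initial velocity [u] inherits this bound; unit vectors with inner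
   product at least 1 coincide. *)
have uw : 1 <= dot u w.
  apply/ler_addgt0Pr => e e0.
  have /filter_ex[s [[s0 sr]]] : \forall s \near (0 : R)^'+, (0 < s /\ s < r) /\
      norm2 (g s - g 0 - (s - 0) *: u) <= e * (s - 0).
    apply: filterI; last exact: gu0.
    by apply: filterI; [exact: nbhs_right_gt|exact: nbhs_right_lt].
  rewrite g0 subr0 => gs; rewrite -(ler_pM2l s0) mulr1.
  have sw : s <= dot (g s - x) w by apply: dotw; rewrite (ltW s0) (ltW sr).
  have := dot_le_norm2 (g s - x - s *: u) w.
  by rewrite w1 mulr1 dotBl dotZl; lra.
apply/eqP; rewrite -subr_eq0; apply/eqP/dotxx_eq0/eqP.
rewrite eq_le dotxx_ge0 andbT !(dotBl, dotBr) (dotC w u) -!sqr_norm2 u1 w1.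
by lra.
Qed.

Lemma integral_curve_right D (I : interval R) (eta : R -> 'rV[R]_n) t b :
  integral_curve D I eta -> t \in I -> b \in I -> t < b ->
  right_deriv eta t (grad D (eta t)).
Proof.
move=> eta_curve tI bI tb; apply: has_deriv_within_right tb _ (eta_curve t tI).
move=> s /=; rewrite in_itv/=; exact: interval_is_interval.
Qed.

Lemma integral_curve_continuous D (I : interval R) (eta : R -> 'rV[R]_n) a b :
  integral_curve D I eta -> a \in I -> b \in I ->
  {within `[a, b], continuous eta}.
Proof.
move=> eta_curve aI bI; apply: (@continuous_subspaceW _ _ _ [set` I]).
  by move=> s /=; rewrite in_itv/=; exact: interval_is_interval.
exact: has_deriv_within_continuous eta_curve.
Qed.

(** [D] rises strictly just to the right of each point before [b]; the Dini argument for [- D] gives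
    monotonicity up to [b], and one strict step after [a] gives strictness. *)
Lemma integral_curve_increasing D (I : interval R) (eta : R -> 'rV[R]_n) a b :
  (forall x, differentiable D x) -> integral_curve D I eta ->
  (forall t, t \in I -> grad D (eta t) != 0) ->
  a \in I -> b \in I -> a < b -> D (eta a) < D (eta b).
Proof.
move=> dD eta_curve eta0 aI bI ab.
have right t : a <= t < b -> \forall s \near t^'+, D (eta t) < D (eta s).
  move=> /andP[at_ tb]; have tI : t \in I.
    by apply: (interval_is_interval aI bI); rewrite at_ ltW.
  apply: right_deriv_grad_lt (dD _) (eta0 _ tI) _.
  exact: integral_curve_right eta_curve tI bI tb.
have mono c : a <= c <= b -> D (eta c) <= D (eta b).
  move=> /andP[ac cb]; rewrite -lerN2.
  apply: (@nonincreasing_right_dini _ (fun t => - D (eta t))) => //.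
    have cI : c \in I by apply: (interval_is_interval aI bI); rewrite ac cb.
    apply/subspace_continuousP => t tcb; apply: cvgN.
    apply: (continuous_cvg _ (differentiable_continuous (dD _))).
    have /subspace_continuousP := integral_curve_continuous eta_curve cI bI.
    exact.
  move=> t e /andP[ct tb] e0; near=> s.
  have ts : t < s by near: s; exact: nbhs_right_gt.
  have Dts : D (eta t) < D (eta s).
    by near: s; apply: right; rewrite tb (le_trans ac).
  have : 0 < e * (s - t) by rewrite mulr_gt0// subr_gt0.
  lra.
have /filter_ex[s [[as_ sb] Das]] : \forall s \near a^'+,
    (a < s /\ s < b) /\ D (eta a) < D (eta s).
  apply: filterI; last by apply: right; rewrite lexx.
  by apply: filterI; [exact: nbhs_right_gt|exact: nbhs_right_lt].
by apply: lt_le_trans Das _; apply: mono; rewrite !ltW.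
Unshelve. all: by end_near. Qed.

End GradientPolicy.

(** * Straightness of integral curves *)

Section StraightCurves.
Context {R : realType} {n : nat}.
Implicit Types (D : 'rV[R]_n -> R) (I : interval R) (eta : R -> 'rV[R]_n).

(* The distance to [{D >= D (eta b)}] drops along [eta] at least as fast as the
   arc length grows, because [eta] moves straight towards a nearest point; as
   this distance is initially at most the chord to [eta b], the triangle
   inequality through [eta t] is an equality. *)
Lemma integral_curve_chord D I eta a t b :
  (forall x, differentiable D x) -> gradient_policy_optimal D ->
  integral_curve D I eta -> (forall s, s \in I -> grad D (eta s) != 0) ->
  a \in I -> b \in I -> a <= t <= b ->
  norm2 (eta a - eta t) + norm2 (eta t - eta b) <= norm2 (eta a - eta b).
Proof.
move=> dD Dopt eta_curve eta0 aI bI /andP[at_ tb].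
pose A := [set y | D (eta b) <= D y].
have cA : closed A.
  apply: (@preimage_closed _ _ D [set c | D (eta b) <= c]); last exact: closed_ge.
  by move=> y _; exact: differentiable_continuous.
have /choice[p pP] : forall x, exists p,
    A p /\ forall y, A y -> norm2 (x - p) <= norm2 (x - y).
  move=> x; have [|p Ap pmin] := closed_nearest_point x _ cA; last by exists p.
  by exists (eta b); rewrite /A /=.
pose dist x := norm2 (x - p x).
have dist_le x y : A y -> dist x <= norm2 (x - y) by have [_] := pP x; exact.
have distB x y : dist x - dist y <= norm2 (x - y).
  rewrite lerBlDr (le_trans (dist_le x (p y) _)) ?norm2_triangle//.
  by have [] := pP y.
have dist_continuous : continuous dist := norm2_lipschitz_continuous distB.
have drop s1 s2 : a <= s1 -> s1 <= s2 -> s2 <= b ->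
    norm2 (eta s1 - eta s2) <= dist (eta s1) - dist (eta s2).
  move=> as1 s12 s2b; have inI s : a <= s <= b -> s \in I.
    by move=> ?; exact: interval_is_interval aI bI _ _.
  have s1I : s1 \in I by rewrite inI// as1 (le_trans s12).
  have s2I : s2 \in I by rewrite inI// s2b (le_trans as1).
  (* With [w] dual to the increment, it suffices that [dist (eta s) + dot (eta s) w] does not
     increase. *)
  have [w w1] := unit_dual (eta s2 - eta s1); rewrite norm2BC => <-.
  suff : dist (eta s2) + dot (eta s2) w <= dist (eta s1) + dot (eta s1) w.
    by rewrite dotBl; lra.
  apply: (@nonincreasing_right_dini _ (fun s => dist (eta s) + dot (eta s) w)) => //.
    have /subspace_continuousP ceta := integral_curve_continuous eta_curve s1I s2I.
    apply/subspace_continuousP => s s12s; apply: cvgD.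
      by apply: (continuous_cvg _ (@dist_continuous _)); exact: ceta.
    by apply: (continuous_cvg _ (@dot_continuous _ _ w _)); exact: ceta.
  move=> s e /andP[s1s ss2] e0.
  have sI : s \in I by rewrite inI// (le_trans as1)// ltW// (lt_le_trans ss2).
  have sb : s < b by rewrite (lt_le_trans ss2).
  have Dsb : D (eta s) < D (eta b).
    exact: integral_curve_increasing dD eta_curve eta0 sI bI sb.
  have [Ap pmin] := pP (eta s).
  have Dsp : D (eta s) < D (p (eta s)) by exact: lt_le_trans Ap.
  have pmin' y : D (p (eta s)) <= D y -> norm2 (eta s - p (eta s)) <= norm2 (eta s - y).
    by move=> Dpy; apply: pmin; exact: le_trans Dpy.
  (* The point of the gradient ray at distance [dist x] lies in [A], so its distance to [eta s']
     bounds [dist (eta s')]. *)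
  have := gradient_ray_reaches_level Dopt Dsp pmin'.
  rewrite -/(dist (eta s)); set x := eta s; set v := grad D x => /(le_trans Ap) Aq.
  have v0 : 0 < norm2 v by rewrite norm2_gt0; exact: eta0.
  have r0 : 0 < dist x.
    rewrite norm2_gt0 subr_eq0; apply: contraTneq Dsp => xp.
    by rewrite -/x -xp ltxx.
  near=> s'.
  have ss' : s < s' by near: s'; exact: nbhs_right_gt.
  (* Ensures that the linear motion [x + (s' - s) *: v] does not overshoot that point. *)
  have s'r : s' < s + dist x / norm2 v.
    by near: s'; apply: nbhs_right_lt; rewrite ltrDl divr_gt0.
  (* Half of [e] pays for the error in [dist], half for that in the [dot] term. *)
  have es' : norm2 (eta s' - x - (s' - s) *: v) <= e / 2 * (s' - s).
    near: s'; apply: (integral_curve_right eta_curve sI bI sb).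
    by rewrite divr_gt0.
  have dist' : dist (eta s') <= dist x - (s' - s) * norm2 v + e / 2 * (s' - s).
    apply: (le_trans (dist_le _ _ Aq)); rewrite [leRHS]addrC.
    apply: (le_trans (norm2_triangle (x + (s' - s) *: v) _ _)).
    apply: lerD; first by rewrite opprD addrA.
    have -> : x + (s' - s) *: v - (x + dist x *: ((norm2 v)^-1 *: v)) =
        (s' - s - dist x / norm2 v) *: v.
      by rewrite opprD addrACA subrr add0r scalerA [in RHS]scalerBl.
    rewrite norm2Z ler0_norm; last by rewrite subr_le0 lerBlDl ltW.
    by rewrite opprB mulrBl divfK ?gt_eqF.
  have := dot_le_norm2 (eta s' - x - (s' - s) *: v) w.
  have := dot_le_norm2 v w; rewrite !dotBl dotZl => vw Nw.
  have : norm2 v * norm2 w <= norm2 v by rewrite ler_piMr ?norm2_ge0.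
  move=> /(le_trans vw); rewrite -(ler_pM2l (_ : 0 < s' - s)) ?subr_gt0// => vw'.
  have : norm2 (eta s' - x - (s' - s) *: v) * norm2 w <= e / 2 * (s' - s).
    by rewrite (le_trans _ es')// ler_piMr ?norm2_ge0.
  lra.
(* Adding both pieces bounds the broken path by [dist (eta a) - dist (eta b)], and this by the chord
   since [eta b] lies in [A]. *)
have := drop a t (lexx a) at_ tb; have := drop t b at_ tb (lexx b).
have := dist_le (eta a) (eta b) (lexx _); have := norm2_ge0 (eta b - p (eta b)).
rewrite -/(dist _); lra.
Unshelve. all: by end_near. Qed.

(** The chord estimate is the equality case of the triangle inequality; strict growth of [D] keeps
    [eta t] distinct from both ends. *)
Lemma integral_curve_between D I eta a t b :
  (forall x, differentiable D x) -> gradient_policy_optimal D ->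
  integral_curve D I eta -> (forall s, s \in I -> grad D (eta s) != 0) ->
  a \in I -> b \in I -> a < t < b ->
  exists2 c, 0 < c < 1 & eta t = eta a + c *: (eta b - eta a).
Proof.
move=> dD Dopt eta_curve eta0 aI bI /andP[at_ tb].
have tI : t \in I by apply: (interval_is_interval aI bI); rewrite !ltW.
have incr := integral_curve_increasing dD eta_curve eta0.
apply: norm2_triangle_eq.
- by apply: contraTneq (incr _ _ aI tI at_) => ->; rewrite ltxx.
- by apply: contraTneq (incr _ _ tI bI tb) => ->; rewrite ltxx.
- by apply: (integral_curve_chord dD Dopt eta_curve eta0 aI bI); rewrite !ltW.
Qed.

End StraightCurves.

Theorem theorem2 (R : realType) (n : nat) (D : 'rV[R]_n -> R)
  (D_gt0 : forall x, 0 < D x)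
  (D_diff : forall x, differentiable D x)
  (D_opt : gradient_policy_optimal D)
  (I : interval R) (eta : R -> 'rV[R]_n)
  (I_neq0 : [set` I] !=set0)
  (eta_curve : integral_curve D I eta)
  (eta_grad : eta @` [set` I] `<=` [set x | grad D x != 0]) :
  in_straight_line (eta @` [set` I]).
Proof.
have eta0 t : t \in I -> grad D (eta t) != 0.
  by move=> tI; apply: eta_grad; exists t.
have between := integral_curve_between D_diff D_opt eta_curve eta0.
have [t0 /= t0I] := I_neq0.
have [[b bI t0b]|single] := pselect (exists2 b, b \in I & b != t0); last first.
  (* When [I] is a single point, any nonzero direction serves. *)
  exists (eta t0), (grad D (eta t0)); split; first exact: eta0.
  move=> _ [t /= tI <-]; exists 0 => //; rewrite scale0r addr0; congr eta.
  by apply/esym/eqP; apply: contrapT => /negP tt0; apply: single; exists t.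
wlog : t0 b t0I bI t0b / t0 < b => [wlg|{}t0b].
  have [bt0|tb] := ltP b t0; first by apply: (wlg b t0); rewrite // eq_sym.
  by apply: (wlg t0 b) => //; rewrite lt_neqAle eq_sym t0b.
have etab : eta b - eta t0 != 0.
  rewrite subr_eq0; apply: contraTneq
    (integral_curve_increasing D_diff eta_curve eta0 t0I bI t0b) => ->.
  by rewrite ltxx.
(* Whichever of [eta t], [eta t0], [eta b] is in the middle, the betweenness relation is solved for
   [eta t]. *)
exists (eta t0), (eta b - eta t0); split=> // _ [t /= tI <-].
case: (ltgtP t t0) => [tt0|t0t|->]; last by exists 0 => //; rewrite scale0r addr0.
  have [c /andP[c0 c1] ->] := between t t0 b tI bI ltac:(by rewrite tt0 t0b).
  have c1' : 1 - c != 0 by rewrite subr_eq0 gt_eqF.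
  (* Here [eta t0] is in the middle: [eta t0 - eta t] and [eta b - eta t0] are [c] and [1 - c] times
     [eta b - eta t]. *)
  exists (- c / (1 - c)) => //.
  have -> : eta b - (eta t + c *: (eta b - eta t)) = (1 - c) *: (eta b - eta t).
    by rewrite opprD addrA scalerBl scale1r.
  by rewrite scalerA divfK// scaleNr addrK.
case: (ltgtP t b) => [tb|bt|->]; last by exists 1 => //; rewrite scale1r addrC subrK.
  have [c _ ->] := between t0 t b t0I bI ltac:(by rewrite t0t tb).
  by exists c.
have [c /andP[c0 _] ->] := between t0 b t t0I tI ltac:(by rewrite t0b bt).
(* Here [eta b] is in the middle, at fraction [c] of the way from [eta t0] to [eta t]. *)
exists c^-1 => //.
by rewrite addrAC subrr add0r scalerA mulVf ?gt_eqF// scale1r addrC subrK.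
Qed.
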